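(* Let $\omega_5=e^{2\pi i/5}$, $\kappa=\frac14(1+i\sqrt{15})$ and $\lambda=\sqrt{-\kappa}$ (principal square root, i.e. $\mathrm{Re}\,\lambda>0$). The matrix $$U_5^{q}=\frac{1}{\sqrt5}\begin{pmatrix}1&1&1&1&1\\-\kappa&-\kappa\omega_5&-\kappa\omega_5^2&-\kappa\omega_5^3&-\kappa\omega_5^4\\ \lambda&\lambda\omega_5^2&\lambda\omega_5^4&\lambda\omega_5^6&\lambda\omega_5^3\\ \kappa&\kappa\omega_5^3&\kappa\omega_5^6&\kappa\omega_5^4&\kappa\omega_5^2\\1&\omega_5^4&\omega_5^3&\omega_5^2&\omega_5\end{pmatrix}$$ is unitary, so that its columns represent an orthonormal basis of $\mathcal H_5$ (spin $j=2$), and this basis is a most quantum basis of $\mathcal H_5$, with $\mathcal B_1(U_5^{q})=\mathcal B_2(U_5^{q})=1$. In particular $\mathcal B_1(U)\le\mathcal B_1(U_5^{q})=1$ for every $U\in U(5)$.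
   Context: For $j\in\{\tfrac12,1,\tfrac32,\dots\}$ let $N=2j+1$ and let $\mathcal H_{N}=\mathbb C^{N}$ be the spin-$j$ Hilbert space with orthonormal basis $\ket{j,m}$, $m=j,j-1,\dots,-j$, of eigenvectors of the angular momentum operator $J_z$. For $0\le k\le 2j$ let $\ket{D_{2j,k}}\in(\mathbb C^2)^{\otimes 2j}$ be the Dicke state: $\binom{2j}{k}^{-1/2}$ times the sum of the $\binom{2j}{k}$ distinct computational basis vectors having exactly $k$ tensor factors $\ket1$ and $2j-k$ tensor factors $\ket0$. Let $F:\mathcal H_{2j+1}\to(\mathbb C^2)^{\otimes 2j}$ be the linear isometry onto the symmetric subspace with $F\ket{j,m}=\ket{D_{2j,j-m}}$. For a unit vector $\ket\psi\in\mathcal H_{2j+1}$ and an integer $1\le t\le 2j$, let $\rho_t$ be the reduced density operator on $t$ qubits obtained from the projector onto $F\ket\psi$ by tracing out $2j-t$ qubits (by symmetry, which ones is irrelevant), and let $R_t(F(\ket\psi))=\mathrm{tr}(\rho_t^2)$. The measure of anticoherence of order $t$ is $$\mathcal A_t(\ket\psi)=\frac{t+1}{t}\bigl[1-R_t(F(\ket\psi))\bigr].$$ A unitary $U\in U(N)$ represents the orthonormal basis $\ket{\psi_1},\dots,\ket{\psi_N}$ of $\mathcal H_N$ whose $i$-th vector is the $i$-th column of $U$, i.e. $U_{ki}=\langle j,m|\psi_i\rangle$ with $m=j+1-k$. The quantumness of the basis is $$\mathcal B_t(U)=\frac1N\sum_{i=1}^N\mathcal A_t(\ket{\psi_i}).$$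 A most quantum basis is one maximizing $\mathcal B_1$ over all $U\in U(N)$. *)

(* Defs.v *)
From HB Require Import structures.
From mathcomp Require Import all_boot all_order all_algebra.
From mathcomp Require Import reals trigo.
From mathcomp Require Export complex.

Set Implicit Arguments.
Unset Strict Implicit.
Unset Printing Implicit Defensive.

Import Order.TTheory GRing.Theory Num.Theory.

Local Open Scope ring_scope.
Local Open Scope complex_scope.
Local Open Scope sesquilinear_scope.

(* Throughout, n stands for 2j, so that j ranges over the positive half       *)
(* integers when n ranges over the positive integers.  The spin-j space is    *)
(* 'cV[R[i]]_n.+1, with coordinate k : 'I_n.+1 along |j, j - k>.              *)

(* (C^2)^{(x) n} is 'cV[R[i]]_(qdim n): its coordinates are indexed, via      *)
(* enum_rank, by the computational basis strings, with true standing for |1>. *)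
Notation bits n := (n.-tuple bool).
Definition qdim (n : nat) : nat := #|{: bits n}|.

Definition ket (R : realType) (n : nat) (b : bits n) : 'cV[R[i]]_(qdim n) :=
  delta_mx (enum_rank b) 0.

Definition dicke (R : realType) (n k : nat) : 'cV[R[i]]_(qdim n) :=
  ((Num.sqrt ('C(n, k)%:R : R))^-1)%:C *:
    \sum_(b : bits n | count_mem true b == k) ket R b.

(* The isometry F : the column of index k is the image of |j, j - k>.         *)
Definition symF (R : realType) (n : nat) : 'M[R[i]]_(qdim n, n.+1) :=
  \matrix_(b, k) dicke R n k b 0.

Definition projector (R : realType) (d : nat) (v : 'cV[R[i]]_d) : 'M[R[i]]_d :=
  v *m v^t*.

(* For t <= n and size c = n - t, this is the concatenation of a and c.       *)
Definition joinbits (n t : nat) (a : bits t) (c : bits (n - t)) : bits n :=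
  [tuple nth false (a ++ c) i | i < n].

(* The operator on the first t qubits obtained by tracing out the last n - t. *)
Definition ptrace (R : realType) (n t : nat) (M : 'M[R[i]]_(qdim n)) :
    'M[R[i]]_(qdim t) :=
  \matrix_(a, b) \sum_(c : bits (n - t))
     M (enum_rank (joinbits (enum_val a) c))
       (enum_rank (joinbits (enum_val b) c)).

Definition reduced (R : realType) (n t : nat) (phi : 'cV[R[i]]_(qdim n)) :
    'M[R[i]]_(qdim t) :=
  ptrace t (projector phi).

Definition purity (R : realType) (n t : nat) (phi : 'cV[R[i]]_(qdim n)) : R[i] :=
  \tr (reduced t phi *m reduced t phi).

(* Meaningful for psi a unit vector and 1 <= t <= n.  This is a real number,  *)
(* represented in R[i], where x <= y means that y - x is real and             *)
(* nonnegative.                                                               *)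
Definition anticoherence (R : realType) (n t : nat) (psi : 'cV[R[i]]_n.+1) :
    R[i] :=
  (t.+1%:R / t%:R) * (1 - purity t (symF R n *m psi)).

Definition quantumness (R : realType) (n t : nat) (U : 'M[R[i]]_n.+1) : R[i] :=
  (n.+1%:R)^-1 * \sum_(i < n.+1) anticoherence t (col i U).

Definition orthonormal_basis (R : realType) (N : nat)
    (psi : 'I_N -> 'cV[R[i]]_N) : Prop :=
  (forall i k : 'I_N, (psi i)^t* *m psi k = (i == k)%:R%:M) /\
  (forall v : 'cV[R[i]]_N, exists c : 'I_N -> R[i],
      v = \sum_(i < N) c i *: psi i).

Definition most_quantum (R : realType) (n : nat) (U : 'M[R[i]]_n.+1) : Prop :=
  U \is unitarymx /\
  forall V : 'M[R[i]]_n.+1, V \is unitarymx -> quantumness 1 V <= quantumness 1 U.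

(* e^{i x}                                                                    *)
Definition expi (R : realType) (x : R) : R[i] := cos x +i* sin x.

Definition omega5 (R : realType) : R[i] := expi (2 * pi / 5).

Definition kappa5 (R : realType) : R[i] := 4^-1 * (1 + 'i * (Num.sqrt (15 : R))%:C).

(* sqrtc is the principal branch, unlike the generic sqrtC, which takes the   *)
(* square root with nonnegative imaginary part.                               *)
Definition lambda5 (R : realType) : R[i] := sqrtc (- kappa5 R).

Lemma lambda5P (R : realType) :
  lambda5 R ^+ 2 = - kappa5 R /\ 0 < complex.Re (lambda5 R).
Proof.
split; first exact: sqr_sqrtc.
rewrite /lambda5.
have k0 : complex.Im (- kappa5 R) != 0.
  have -> : kappa5 R = 4^-1%:C * (1 +i* Num.sqrt 15).
    by rewrite /kappa5 fmorphV rmorph_nat; congr (_ * _); simpc.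
  by rewrite /=; simpc; rewrite oppr_eq0 mulf_neq0 // ?invr_eq0 ?pnatr_eq0 // sqrtr_eq0 -ltNge ltr0n.
case: (- kappa5 R) k0 => a b /= b0.
rewrite sqrtr_gt0 divr_gt0 // -ltrBlDr sub0r.
apply: (le_lt_trans (ler_norm _)); rewrite normrN -sqrtr_sqr.
rewrite ltr_sqrt ?ltrDl ?exprn_even_gt0 //.
by rewrite ltr_wpDl ?sqr_ge0 // exprn_even_gt0.
Qed.

Definition U5q (R : realType) : 'M[R[i]]_5 :=
  let w := omega5 R in let ka := kappa5 R in let la := lambda5 R in
  ((Num.sqrt (5 : R))^-1)%:C *:
  \matrix_(i < 5, k < 5) nth 0 (nth [::]
    [:: [:: 1;    1;            1;            1;            1           ];
        [:: - ka; - ka * w;     - ka * w ^+ 2; - ka * w ^+ 3; - ka * w ^+ 4];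
        [:: la;   la * w ^+ 2;  la * w ^+ 4;  la * w ^+ 6;  la * w ^+ 3 ];
        [:: ka;   ka * w ^+ 3;  ka * w ^+ 6;  ka * w ^+ 4;  ka * w ^+ 2 ];
        [:: 1;    w ^+ 4;       w ^+ 3;       w ^+ 2;       w           ]]
    i) k.

(* Main.v *)
(* For a unit vector, rho_1 is a Hermitian 2 x 2 matrix of trace 1, so its     *)
(* purity is at least 1/2 and A_1 <= 1; hence B_1 <= 1 for every basis.        *)
(* The columns of U5q are the orbit of the first one under the rotation        *)
(* diag(w^k), which preserves purities, so only that column matters.  Since    *)
(* lambda = sqrt 6 * (3 - sqrt(-15)) / 12, the binomial weight of the middle   *)
(* Dicke state cancels and the reduced states of F|psi_1> lie in Q(sqrt(-15)): *)
(* rho_1 and rho_2 are the maximally mixed states of the symmetric subspaces,  *)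
(* of purity 1/2 and 1/3, giving A_1 = A_2 = 1.                                *)
Require Import Defs.
From mathcomp Require Import all_boot all_order all_algebra.
From mathcomp Require Import reals trigo ring lra.

Set Implicit Arguments.
Unset Strict Implicit.
Unset Printing Implicit Defensive.

Import Order.TTheory GRing.Theory Num.Theory.

Local Open Scope ring_scope.
Local Open Scope complex_scope.
Local Open Scope sesquilinear_scope.

(** A symmetric state has equal coefficients on strings of equal weight, so [purity_rdm] turns
    tr(rho_t^2) into a sum over pairs of weights p, q <= t with binomial multiplicities. Upper
    bound: completing squares for a Hermitian 2 x 2 matrix of trace 1 ([purity1_ge_half]) gives A_1
    <= 1 for every column. Attainment: [U5q] is a unimodular diagonal matrix times a Fourier matrix,
    hence unitary. Its columns differ by z-rotations ([purity_rotate]), and the first column has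
    maximally mixed rho_1 and rho_2 ([rdm_U5q_mixed]), a finite computation in Q(sqrt(-15)). *)

(** * Sums over bit strings, grouped by weight *)

Lemma big_bits_recl (V : nmodType) m (F : bits m.+1 -> V) :
  \sum_(c : bits m.+1) F c =
  \sum_(c : bits m) F [tuple of false :: c] + \sum_(c : bits m) F [tuple of true :: c].
Proof.
pose h (p : bool * bits m) : bits m.+1 := [tuple of p.1 :: p.2].
have h_bij : bijective h.
  exists (fun c : bits m.+1 => (thead c, [tuple of behead c])).
    by case=> b c; rewrite /h theadE; congr pair; apply: val_inj.
  by move=> c; rewrite /h -tuple_eta.
rewrite (reindex h) /=; last exact: onW_bij.
rewrite -(pair_bigA _ (fun b c => F (h (b, c)))) big_bool.
by rewrite addrC.
Qed.

(** Pascal's rule under the sum: strings of length m + 1 are sorted by their first bit. *)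
Lemma sum_binS (V : nmodType) m (g : nat -> V) :
  \sum_(s < m.+2) g s *+ 'C(m.+1, s) =
  \sum_(s < m.+1) g s *+ 'C(m, s) + \sum_(s < m.+1) g s.+1 *+ 'C(m, s).
Proof.
rewrite [LHS]big_ord_recl bin0.
under [X in _ + X = _]eq_bigr do rewrite binS mulrnDr.
rewrite big_split /= addrA; congr (_ + _).
rewrite [RHS]big_ord_recl [X in _ + X = _]big_ord_recr /=.
by rewrite (bin_small (ltnSn _)) mulr0n addr0 bin0.
Qed.

Lemma sum_bits_count (V : nmodType) m (g : nat -> V) :
  \sum_(c : bits m) g (count_mem true c) = \sum_(s < m.+1) g s *+ 'C(m, s).
Proof.
elim: m g => [|m IH] g.
  rewrite big_ord1 bin0 (big_pred1 [tuple]) // => c.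
  exact/esym/eqP/tuple0.
by rewrite big_bits_recl sum_binS /= (IH g) (IH (fun s => g s.+1)).
Qed.

Lemma count_joinbits n t (a : bits t) (c : bits (n - t)) : (t <= n)%N ->
  count_mem true (joinbits a c) = (count_mem true a + count_mem true c)%N.
Proof.
move=> le_tn; rewrite -count_cat; congr count.
have sz : size (a ++ c) = n by rewrite size_cat !size_tuple subnKC.
apply: (@eq_from_nth _ false); first by rewrite size_tuple sz.
rewrite size_tuple => i lt_in.
by rewrite /joinbits /= (nth_map (Ordinal lt_in)) ?size_enum_ord // nth_enum_ord.
Qed.

(** * Reduced states and purity in terms of weights *)

(* The coefficient of F |psi> on any computational basis string of weight s;  *)
(* junk for s > n.                                                            *)
Definition amplitude (R : realType) n (psi : 'cV[R[i]]_n.+1) (s : nat) : R[i] :=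
  ((Num.sqrt ('C(n, s)%:R : R))^-1)%:C * psi (inord s) 0.

Lemma symF_amplitude (R : realType) n (psi : 'cV[R[i]]_n.+1) (b : bits n) :
  (symF R n *m psi) (enum_rank b) 0 = amplitude psi (count_mem true b).
Proof.
have wt_b : (count_mem true b < n.+1)%N.
  by rewrite ltnS -[X in (_ <= X)%N](size_tuple b) count_size.
rewrite mxE (bigD1 (inord (count_mem true b))) //= big1 ?addr0 => [|k ne_kb].
  rewrite /amplitude !mxE inordK // summxE (bigD1 b) //= big1 => [|c /andP[_ ne_cb]].
    by rewrite mxE !eqxx addr0 mulr1.
  by rewrite mxE (inj_eq enum_rank_inj) eq_sym (negPf ne_cb).
rewrite !mxE summxE big1 ?mulr0 ?mul0r // => c /eqP wt_c.
rewrite mxE (inj_eq enum_rank_inj); case: eqP => // eq_bc.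
by rewrite eq_bc wt_c inord_val eqxx in ne_kb.
Qed.

(* The entry of rho_t between basis strings of weights p and q; the 'C(n - t, s) *)
(* traced-out strings of weight s contribute equally. *)
Definition rdm (R : realType) n t (psi : 'cV[R[i]]_n.+1) (p q : nat) : R[i] :=
  \sum_(s < (n - t).+1)
    (amplitude psi (p + s) * Num.conj (amplitude psi (q + s))) *+ 'C(n - t, s).

Lemma reduced_rdm (R : realType) n t (psi : 'cV[R[i]]_n.+1) (a b : bits t) :
  (t <= n)%N ->
  reduced t (symF R n *m psi) (enum_rank a) (enum_rank b) =
  rdm t psi (count_mem true a) (count_mem true b).
Proof.
move=> le_tn; have := symF_amplitude psi.
move: (symF R n *m psi) => phi phiE; rewrite mxE !enum_rankK /rdm.
rewrite -(sum_bits_count _ (fun s => amplitude psi (_ + s) * Num.conj (amplitude psi (_ + s)))).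
by apply: eq_bigr => c _; rewrite mxE big_ord1 !mxE !phiE !count_joinbits.
Qed.

Lemma purity_rdm (R : realType) n t (psi : 'cV[R[i]]_n.+1) : (t <= n)%N ->
  purity t (symF R n *m psi) =
  \sum_(p < t.+1) \sum_(q < t.+1)
    (rdm t psi p q * rdm t psi q p) *+ 'C(t, q) *+ 'C(t, p).
Proof.
move=> le_tn; rewrite /purity /mxtrace.
rewrite (reindex (@enum_rank (bits t))); last exact/onW_bij/enum_rank_bij.
under [RHS]eq_bigr do rewrite sumrMnl.
rewrite -(sum_bits_count t (fun p => \sum_(q < t.+1) (rdm t psi p q * rdm t psi q p) *+ 'C(t, q))).
apply: eq_bigr => a _; rewrite mxE.
rewrite (reindex (@enum_rank (bits t))); last exact/onW_bij/enum_rank_bij.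
rewrite -(sum_bits_count t (fun q => rdm t psi _ q * rdm t psi q _)).
by apply: eq_bigr => b _; rewrite !reduced_rdm.
Qed.

Lemma conj_rdm (R : realType) n t (psi : 'cV[R[i]]_n.+1) p q :
  Num.conj (rdm t psi p q) = rdm t psi q p.
Proof.
rewrite /rdm rmorph_sum; apply: eq_bigr => s _.
by rewrite rmorphMn rmorphM /= conjCK mulrC.
Qed.

(** * Normalisation and the bound on the order-1 quantumness *)

Lemma amplitude_norm (R : realType) n (psi : 'cV[R[i]]_n.+1) s : (s <= n)%N ->
  amplitude psi s * Num.conj (amplitude psi s) *+ 'C(n, s) = `|psi (inord s) 0| ^+ 2.
Proof.
move=> le_sn; rewrite -normCK normrM exprMn -mulrnAl.
suff -> : `|((Num.sqrt ('C(n, s)%:R : R))^-1)%:C| ^+ 2 *+ 'C(n, s) = 1 by rewrite mul1r.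
rewrite normc_def /= expr0n addr0 sqrtr_sqr.
rewrite ger0_norm ?invr_ge0 ?sqrtr_ge0 // -rmorphXn exprVn sqr_sqrtr ?ler0n //.
by rewrite fmorphV rmorph_nat -mulr_natr mulVf // pnatr_eq0 -lt0n bin_gt0.
Qed.

(** This is tr(rho_1) = <psi|psi>: Pascal's rule splits the strings of each weight by the value of
    the qubit that is kept. *)
Lemma rdm1_trace (R : realType) n (psi : 'cV[R[i]]_n.+2) : psi^t* *m psi = 1%:M ->
  rdm 1 psi 0 0 + rdm 1 psi 1 1 = 1.
Proof.
move=> /matrixP/(_ 0 0); rewrite !mxE eqxx mulr1n => <-.
transitivity (\sum_(s < n.+2) (amplitude psi s * Num.conj (amplitude psi s)) *+ 'C(n.+1, s)).
  by rewrite (sum_binS n (fun s => amplitude psi s * Num.conj (amplitude psi s))) /rdm subn1.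
apply: eq_bigr => s _; rewrite amplitude_norm -1?ltnS // inord_val normCK !mxE.
by rewrite mulrC.
Qed.

Lemma purity1_ge_half (R : realType) n (psi : 'cV[R[i]]_n.+2) :
  psi^t* *m psi = 1%:M -> 2^-1 <= purity 1 (symF R n.+1 *m psi).
Proof.
move=> /rdm1_trace tr1.
rewrite purity_rdm // !big_ord_recl !big_ord0 /= /bump /= !bin0 !binn !mulr1n !addr0.
set a := rdm 1 psi 0 0 in tr1 *; set d := rdm 1 psi 1 1 in tr1 *.
have a_real : Num.conj a = a by rewrite conj_rdm.
have -> : d = 1 - a by rewrite -tr1 addrC addKr.
rewrite -(conj_rdm _ _ 0 1) -normCK [Num.conj _ * _]mulrC -normCK.
set b := rdm _ _ _ _.
rewrite -subr_ge0.
(* With diagonal a, 1 - a and off-diagonal entry b, the excess of the purity over 1/2 is a sum of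
   squares, as a is real. *)
have -> : a * a + `|b| ^+ 2 + (`|b| ^+ 2 + (1 - a) * (1 - a)) - 2^-1
  = 2 * `|b| ^+ 2 + 2 * `|a - 2^-1| ^+ 2.
  rewrite [`|a - _| ^+ 2]normCK rmorphB /= a_real fmorphV rmorph_nat.
  by field.
by rewrite addr_ge0 // mulr_ge0 ?ler0n ?exprn_ge0.
Qed.

(** [unitarymx] speaks of rows; passing to the adjoint gives the columns. *)
Lemma col_unitary_norm (R : realType) n (U : 'M[R[i]]_n) i k :
  U \is unitarymx -> (col i U)^t* *m col k U = (i == k)%:R%:M.
Proof.
rewrite -trmxC_unitary => /unitarymxP; rewrite trmxCK => /matrixP/(_ i k) E.
apply/matrixP => u v; rewrite !ord1 mxE [RHS]mxE mulr1n; move: E; rewrite !mxE => <-.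
by apply: eq_bigr => l _; rewrite !mxE.
Qed.

Lemma unitary_orthonormal_basis (R : realType) n (U : 'M[R[i]]_n) :
  U \is unitarymx -> orthonormal_basis (fun i => col i U).
Proof.
move=> U_unitary; split=> [i k|v]; first exact: col_unitary_norm.
exists (fun i => (U^t* *m v) i 0).
have /unitarymxP UU := U_unitary.
rewrite -[LHS]mul1mx -UU -mulmxA.
apply/colP => l; rewrite mxE summxE; apply: eq_bigr => i _.
by rewrite [RHS]mxE [X in _ = _ * X]mxE mulrC.
Qed.

Lemma quantumness1_le1 (R : realType) n (U : 'M[R[i]]_n.+2) :
  U \is unitarymx -> quantumness 1 U <= 1.
Proof.
move=> U_unitary; rewrite /quantumness mulrC ler_pdivrMr ?ltr0n // mul1r.
rewrite -[X in _ <= X%:R]card_ord -sumr_const; apply: ler_sum => i _.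
rewrite /anticoherence divr1 mulrBr mulr1.
have /purity1_ge_half : (col i U)^t* *m col i U = 1%:M.
  by rewrite col_unitary_norm // eqxx.
rewrite -(ler_pM2l (x := 2)) ?ltr0n // mulfV ?pnatr_eq0 //.
rewrite lerBlDr; have -> : 2 = 1 + 1 :> R[i] by [].
by rewrite lerD2l.
Qed.

(** * The constants [omega5], [kappa5] and [lambda5] *)

Lemma conj_real (R : realType) (x : R) : Num.conj (x%:C) = x%:C.
Proof. exact: conjc_real. Qed.

Lemma omega5X (R : realType) k : omega5 R ^+ k = expi (2 * pi / 5 *+ k).
Proof.
elim: k => [|k IH]; first by rewrite expr0 mulr0n /expi cos0 sin0.
rewrite exprSr IH [_ *+ k.+1]mulrSr /omega5 /expi cosD sinD; simpc.
by rewrite [X in _ +i* X]addrC.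
Qed.

(** The order divides the prime 5, and it is not 1 because sin(2 pi / 5) > 0. *)
Lemma omega5_prim (R : realType) : 5.-primitive_root (omega5 R).
Proof.
have w5 : omega5 R ^+ 5 = 1.
  rewrite omega5X -mulr_natr mulfVK ?pnatr_eq0 // mulr_natl.
  by rewrite /expi cos2pi sin2pi.
have [m m_prim] := prim_order_exists (isT : (0 < 5)%N) w5.
rewrite (dvdn_divisors _ (isT : (0 < 5)%N)) !inE => /pred2P[] m_eq.
  have := prim_expr_order m_prim; rewrite m_eq expr1 => /(congr1 (@complex.Im R)) /= sin0_.
  have : 0 < sin (2 * pi / 5 : R).
    have := pi_gt0 R => pi0.
    by apply: sin_gt0_pi; apply/andP; split; lra.
  by rewrite sin0_ ltxx.
have m5 : m = 5%N by [].
by rewrite m5 in m_prim.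
Qed.

Definition sqrtN15 (R : realType) : R[i] := 'i * (Num.sqrt (15 : R))%:C.

Lemma sqr_sqrtN15 (R : realType) : sqrtN15 R * sqrtN15 R = - 15.
Proof.
rewrite /sqrtN15 mulrACA -rmorphM -!expr2 sqr_sqrtr ?ler0n // rmorph_nat.
have -> : 'i ^+ 2 = -1 :> R[i] by apply: sqr_i.
by rewrite mulN1r.
Qed.

Lemma conj_sqrtN15 (R : realType) : Num.conj (sqrtN15 R) = - sqrtN15 R.
Proof.
by rewrite /sqrtN15; apply/eqP; rewrite eq_complex /=; simpc.
Qed.

Lemma kappa5E (R : realType) : kappa5 R = (1 + sqrtN15 R) / 4.
Proof. by rewrite mulrC. Qed.

(** Both sides square to -kappa; the positive real part of the principal root settles the sign. *)
Lemma lambda5E (R : realType) : lambda5 R = (Num.sqrt (6 : R))%:C * ((3 - sqrtN15 R) / 12).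
Proof.
have [la2 la_gt0] := lambda5P R.
set r := RHS.
have r2 : r ^+ 2 = - kappa5 R.
  rewrite /r exprMn -rmorphXn sqr_sqrtr ?ler0n // rmorph_nat kappa5E.
  by field: (sqr_sqrtN15 R).
have := eqf_sqr (lambda5 R) r; rewrite la2 r2 eqxx => /esym/pred2P[] // la_eq.
suff Re_r : complex.Re r = Num.sqrt 6 / 4.
  have ReN (x : R[i]) : complex.Re (- x) = - complex.Re x by case: x.
  move: la_gt0; rewrite la_eq ReN Re_r oppr_gt0 => /ltW.
  by rewrite leNgt divr_gt0 // sqrtr_gt0.
suff /(congr1 (@complex.Re R)) : (complex.Re r)%:C = (Num.sqrt 6 / 4)%:C by [].
rewrite ReJ_add -[r^*]/(Num.conj r) /r rmorphM fmorph_div /= rmorphB /= conj_sqrtN15 !conjC_nat.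
rewrite conj_real [RHS]rmorphM fmorphV rmorph_nat.
by field.
Qed.

(** * Unitarity of [U5q] *)

Lemma U5qE (R : realType) (i k : 'I_5) :
  U5q R i k = ((Num.sqrt (5 : R))^-1)%:C *
    nth 0 [:: 1; - kappa5 R; lambda5 R; kappa5 R; 1] i * omega5 R ^+ (i * k).
Proof.
(* Exponents matter modulo 5 only; [w6] treats the entries written with the unreduced exponent 6. *)
have w_prim := omega5_prim R; have w6 := prim_expr_mod w_prim 6.
rewrite mxE -mulrA; congr (_ * _); rewrite mxE -(prim_expr_mod w_prim (i * k)).
case: i => [[|[|[|[|[|i]]]]] // ?]; case: k => [[|[|[|[|[|k]]]]] // ?] /=;
  by rewrite ?muln0 ?expr0 ?expr1 ?mulr1 ?mul1r -?w6.
Qed.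

Lemma omega5_norm (R : realType) : `|omega5 R| = 1.
Proof. by rewrite normc_def /= cos2Dsin2 sqrtr1. Qed.

Lemma kappa5_norm (R : realType) : kappa5 R * Num.conj (kappa5 R) = 1.
Proof.
rewrite kappa5E fmorph_div rmorphD /= conj_sqrtN15 !conjC_nat.
by field: (sqr_sqrtN15 R).
Qed.

Lemma lambda5_norm (R : realType) : lambda5 R * Num.conj (lambda5 R) = 1.
Proof.
rewrite lambda5E rmorphM fmorph_div rmorphB /= conj_sqrtN15 !conjC_nat conj_real.
rewrite mulrACA -rmorphM -expr2 sqr_sqrtr ?ler0n // rmorph_nat.
by field: (sqr_sqrtN15 R).
Qed.

Lemma sqr_invsqrt5 (R : realType) : ((Num.sqrt (5 : R))^-1)%:C * ((Num.sqrt (5 : R))^-1)%:C = 5^-1.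
Proof.
by rewrite -rmorphM -expr2 exprVn sqr_sqrtr ?ler0n // fmorphV rmorph_nat.
Qed.

(* Up to the unimodular factors kappa5 and lambda5, U5q is the Fourier matrix of Z/5. *)
Lemma U5q_unitary (R : realType) : U5q R \is unitarymx.
Proof.
have w_prim := omega5_prim R; set w := omega5 R in w_prim.
have w_conj : Num.conj w = w ^-1.
  by rewrite invC_norm omega5_norm expr1n invr1 mul1r.
pose d (i : 'I_5) := nth 0 [:: 1; - kappa5 R; lambda5 R; kappa5 R; 1] i.
have d_norm i : d i * Num.conj (d i) = 1.
  case: i => [[|[|[|[|[|i]]]]] // ?]; rewrite /d /= ?rmorphN ?mulrNN ?kappa5_norm ?lambda5_norm //.
    by rewrite conjC1 mulr1.
  by rewrite conjC1 mulr1.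
apply/unitarymxP/matrixP => i j; rewrite mxE [RHS]mxE.
transitivity (5^-1 * (d i * Num.conj (d j)) * \sum_(k < 5) (w ^+ i / w ^+ j) ^+ k).
  rewrite mulr_sumr; apply: eq_bigr => k _.
  rewrite [_^t* _ _]mxE [_^T _ _]mxE !U5qE -/w -/(d i) -/(d j).
  rewrite !rmorphM rmorphXn /= w_conj conj_real -sqr_invsqrt5 !exprM exprMn !exprVn.
  by ring.
have w_neq0 : w != 0 by rewrite -normr_gt0 omega5_norm ltr01.
have [<-|ne_ij] := eqVneq i j.
  rewrite divff ?expf_neq0 // d_norm.
  under eq_bigr do rewrite expr1n.
  by rewrite sumr_const card_ord mulr1 mulVf // pnatr_eq0.
have u_neq1 : w ^+ i / w ^+ j != 1.
  rewrite -(inj_eq (mulIf (expf_neq0 j w_neq0))) mulfVK ?expf_neq0 // mul1r.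
  by rewrite (eq_prim_root_expr w_prim) !modn_small.
(* The ratio u satisfies u^5 = 1 and u != 1, so the geometric sum vanishes. *)
have := subrX1 (w ^+ i / w ^+ j) 5.
rewrite exprMn exprVn -!exprM ![(_ * 5)%N]mulnC !exprM (prim_expr_order w_prim).
rewrite !expr1n divr1 subrr => /esym/eqP; rewrite mulf_eq0 subr_eq0 (negPf u_neq1) /= => /eqP ->.
by rewrite mulr0.
Qed.

(** * Anticoherence of the columns of [U5q] *)

(** The rotation acts as diag(1, z) on each qubit. The (p, q) entry of rho_t gains the phase z^p
    conj(z)^q, which cancels against that of the (q, p) entry. *)
Lemma purity_rotate (R : realType) n t (z : R[i]) (psi psi' : 'cV[R[i]]_n.+1) :
  (t <= n)%N -> `|z| = 1 -> (forall k, psi' k 0 = z ^+ k * psi k 0) ->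
  purity t (symF R n *m psi') = purity t (symF R n *m psi).
Proof.
move=> le_tn z_norm psi'E.
have zz k : z ^+ k * Num.conj z ^+ k = 1.
  by rewrite -exprMn -normCK z_norm !expr1n.
have ampE s : (s <= n)%N -> amplitude psi' s = z ^+ s * amplitude psi s.
  by move=> le_sn; rewrite /amplitude psi'E inordK // mulrCA.
have rdmE (p q : 'I_t.+1) :
    rdm t psi' p q = z ^+ p * Num.conj z ^+ q * rdm t psi p q.
  rewrite /rdm mulr_sumr; apply: eq_bigr => s _.
  have le_n (r : 'I_t.+1) : (r + s <= n)%N.
    by rewrite (leq_trans (leq_add (leq_ord r) (leq_ord s))) // subnKC.
  rewrite mulrnAr !ampE // [Num.conj (_ * _)]rmorphM rmorphXn /= !exprD.
  move: (amplitude _ _) (Num.conj (amplitude _ _)) => u v; congr GRing.natmul.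
  rewrite -[RHS]mulr1 -(zz s); move: (Num.conj z) => y.
  by ring.
rewrite !purity_rdm //; apply: eq_bigr => p _; apply: eq_bigr => q _.
rewrite !rdmE mulrACA [X in X * _](_ : _ = 1) ?mul1r //.
by rewrite mulrACA [Num.conj z ^+ q * _]mulrC mulrACA !zz mulr1.
Qed.

(* The amplitudes of the first column of U5q are those of this vector over sqrt 5. *)
Definition U5q_amplitudes (R : realType) (x : R[i]) : seq R[i] :=
  [:: 1; - (1 + x) / 8; (3 - x) / 12; (1 + x) / 8; 1].

Lemma amplitude_U5q (R : realType) (s : nat) : (s < 5)%N ->
  amplitude (col 0 (U5q R)) s =
  ((Num.sqrt (5 : R))^-1)%:C * (U5q_amplitudes (sqrtN15 R))`_s.
Proof.
move=> lt_s5; rewrite /amplitude mxE U5qE inordK // muln0 expr0 mulr1 mulrCA; congr (_ * _).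
have sqrt4 : Num.sqrt (4 : R) = 2.
  by rewrite -[4](_ : 2 ^+ 2 = _) ?sqrtr_sqr ?ger0_norm ?ler0n // -natrX.
case: s lt_s5 => [|[|[|[|[|s]]]]] // _ /=.
- by rewrite bin0 sqrtr1 invr1 mul1r.
- rewrite bin1 sqrt4 kappa5E fmorphV rmorph_nat.
  by field.
- rewrite lambda5E mulrA fmorphV mulVf ?mul1r // (_ : 'C(4, 2) = 6%N) //.
  by rewrite fmorph_eq0 gt_eqF // sqrtr_gt0.
- rewrite (_ : 'C(4, 3) = 4%N) // sqrt4 kappa5E fmorphV rmorph_nat.
  by field.
- by rewrite binn sqrtr1 invr1 mul1r.
Qed.

(** Conjugation acts on Q(sqrt(-15)) by x -> -x, hence the parameter x of [U5q_amplitudes]. *)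
Lemma conj_amplitude_U5q (R : realType) (s : nat) : (s < 5)%N ->
  Num.conj (amplitude (col 0 (U5q R)) s) =
  ((Num.sqrt (5 : R))^-1)%:C * (U5q_amplitudes (- sqrtN15 R))`_s.
Proof.
move=> lt_s5; rewrite amplitude_U5q // rmorphM [X in X * _]conj_real; congr (_ * _).
have fE := (fmorph_div, rmorphD, rmorphN, conj_sqrtN15, conjC_nat, conjC1).
by case: s lt_s5 => [|[|[|[|[|s]]]]] // _; rewrite /= !fE /= ?fE.
Qed.

Lemma rdm_U5q (R : realType) t p q : (t <= 4)%N -> (p <= t)%N -> (q <= t)%N ->
  rdm t (col 0 (U5q R)) p q = 5^-1 * \sum_(s < (4 - t).+1)
    (U5q_amplitudes (sqrtN15 R))`_(p + s) * (U5q_amplitudes (- sqrtN15 R))`_(q + s)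
      *+ 'C(4 - t, s).
Proof.
move=> le_t4 le_pt le_qt; rewrite mulr_sumr; apply: eq_bigr => s _.
have lt5 r : (r <= t)%N -> (r + s < 5)%N.
  by move=> le_rt; rewrite ltnS (leq_trans (leq_add le_rt (leq_ord s))) // subnKC.
rewrite conj_amplitude_U5q ?amplitude_U5q ?lt5 // mulrACA -sqr_invsqrt5.
by rewrite mulrnAr.
Qed.

(* rho_t is the maximally mixed state on the symmetric subspace. *)
Lemma rdm_U5q_mixed (R : realType) t p q :
  (0 < t <= 2)%N -> (p <= t)%N -> (q <= t)%N ->
  rdm t (col 0 (U5q R)) p q = (p == q)%:R / (t.+1 * 'C(t, p))%:R.
Proof.
have J2 := sqr_sqrtN15 R.
have C21 : 'C(2, 1) = 2%N by [].
have C32 : 'C(3, 2) = 3%N by [].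
case: t p q => [|[|[|t]]] // [|[|[|p]]] // [|[|[|q]]] // _ _ _.
(* With [sqrtN15] abstracted to J, each case is an identity modulo J^2 = -15. *)
all: rewrite rdm_U5q // /U5q_amplitudes; move: (sqrtN15 R) J2 => J J2.
all: rewrite !(subSS, subn0) !big_ord_recr big_ord0 /= !(bin0, bin1, binn, C21, C32).
all: by field: J2.
Qed.

Lemma anticoherence_U5q (R : realType) t : (0 < t <= 2)%N ->
  anticoherence t (col 0 (U5q R)) = 1.
Proof.
move=> t12; have /andP[t_gt0 t_le2] := t12.
rewrite /anticoherence purity_rdm ?(leq_trans t_le2) //.
(* Only q = p survives, and 'C(t, p)^2 cancels the squared entry's denominator: each p gives
   1/(t+1)^2, so the purity is 1/(t+1). *)
rewrite (eq_bigr (fun=> t.+1%:R^-1 ^+ 2)) => [|p _].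
  rewrite sumr_const card_ord -mulr_natr.
  by field; rewrite nat1r !pnatr_eq0 /= -lt0n.
rewrite (bigD1 p) //= big1 ?addr0 => [|q ne_qp].
  rewrite !rdm_U5q_mixed ?leq_ord // eqxx mulr1n natrM.
  have C_neq0 : ('C(t, p)%:R : R[i]) != 0.
    by rewrite pnatr_eq0 -lt0n bin_gt0 leq_ord.
  by field; rewrite C_neq0 nat1r pnatr_eq0.
have ne_val : (val q == val p) = false := negbTE ne_qp.
by rewrite !rdm_U5q_mixed ?leq_ord // ne_val mul0r mulr0 !mul0rn.
Qed.

Lemma quantumness_U5q (R : realType) t : (0 < t <= 2)%N ->
  quantumness t (U5q R) = 1.
Proof.
move=> t12; rewrite /quantumness (eq_bigr (fun=> 1)) => [|k _].
  by rewrite sumr_const card_ord mulVf ?pnatr_eq0.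
have /andP[_ t_le2] := t12.
rewrite -(anticoherence_U5q R t12) /anticoherence.
rewrite (purity_rotate (z := omega5 R ^+ k) (psi := col 0 (U5q R))) //.
- by rewrite (leq_trans t_le2).
- by rewrite normrX omega5_norm expr1n.
by move=> i; rewrite [LHS]mxE [X in _ = _ * X]mxE !U5qE muln0 expr0 mulr1 mulrC -exprM mulnC.
Qed.

Theorem proposition3 (R : realType) :
  [/\ U5q R \is unitarymx,
      orthonormal_basis (fun i : 'I_5 => col i (U5q R)),
      most_quantum (U5q R),
      quantumness 1 (U5q R) = 1 /\ quantumness 2 (U5q R) = 1
    & forall U : 'M[R[i]]_5, U \is unitarymx -> quantumness 1 U <= 1].
Proof.
have U_unitary := U5q_unitary R.
split.
- exact: U_unitary.
- exact: unitary_orthonormal_basis.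
- split; first exact: U_unitary.
  by move=> V V_unitary; rewrite quantumness_U5q //; exact: quantumness1_le1.
- by split; exact: quantumness_U5q.
- by move=> U; exact: quantumness1_le1.
Qed.
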